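(* Let $q\in(0,1)$, let $\gamma>0$ be real and let $0<p<\infty$. For each $k\in\mathbb{Z}^+_0$ define the sequence $\zeta^{(k)}(q)=(\zeta^{(k)}_j(q))_{j\in\mathbb{Z}^+_0}$, an element of $\ell_p(\nabla^{(\gamma)}_q)$, by $$\zeta^{(k)}_j(q)=\begin{cases}\dfrac{\prod_{i=0}^{j-k-1}[\gamma+i]_q}{[j-k]_q!},&0\le k\le j,\\[2mm]0,&\text{otherwise.}\end{cases}$$ Then: (1) The sequence $\{\zeta^{(k)}(q)\}_{k\in\mathbb{Z}^+_0}$ is a (Schauder) basis of $\ell_p(\nabla^{(\gamma)}_q)$, and each $g\in\ell_p(\nabla^{(\gamma)}_q)$ has the unique representation $$g=\sum_{k=0}^\infty h_k\,\zeta^{(k)}(q),$$ where $h_j=(\nabla^{(\gamma)}_q g)_j$ for each $j\in\mathbb{Z}^+_0$. (2) The space $\ell_\infty(\nabla^{(\gamma)}_q)$ has no Schauder basis.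
   Context: $\mathbb{Z}^+_0=\{0,1,2,\dots\}$, and $\omega$ is the complex vector space of all complex sequences $g=(g_j)_{j\in\mathbb{Z}^+_0}$. For real $x$, $[x]_q=\frac{1-q^x}{1-q}$; $[0]_q!=1$ and $[k]_q!=\prod_{i=1}^k[i]_q$. Empty products equal $1$. The $q$-difference operator $\nabla^{(\gamma)}_q:\omega\to\omega$ is $$(\nabla^{(\gamma)}_q g)_j=\sum_{k=0}^{j}(-1)^{j-k}q^{\binom{j-k}{2}}\frac{\prod_{i=0}^{j-k-1}[\gamma-i]_q}{[j-k]_q!}\,g_k .$$ For $\mathfrak X\in\{\ell_p,\ell_\infty\}$, $\mathfrak X(\nabla^{(\gamma)}_q)=\{g\in\omega:\nabla^{(\gamma)}_q g\in\mathfrak X\}$, with $\Vert g\Vert=\Vert\nabla^{(\gamma)}_q g\Vert_{\mathfrak X}$, where $\Vert h\Vert_{\ell_p}=(\sum_j|h_j|^p)^{1/p}$ if $1\le p<\infty$, $\Vert h\Vert_{\ell_p}=\sum_j|h_j|^p$ (a $p$-norm) if $0<p<1$, and $\Vert h\Vert_{\ell_\infty}=\sup_j|h_j|$. A sequence $(b_k)$ in a ($p$-)normed space is a Schauder basis if for each element $g$ there is a sequence of scalars $(\alpha_k)$ with $\lim_{j\to\infty}\Vert g-\sum_{k=0}^j\alpha_k b_k\Vert=0$; infinite sums of elements are understood in this sense. *)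

(* Defs.v *)
From mathcomp Require Export all_boot all_order all_algebra.
From mathcomp Require Export all_classical all_reals all_analysis.
From mathcomp Require Export complex.

Set Implicit Arguments.
Unset Strict Implicit.
Unset Printing Implicit Defensive.

Import Order.TTheory GRing.Theory Num.Theory.
Import numFieldNormedType.Exports.

Local Open Scope classical_set_scope.
Local Open Scope ring_scope.
Local Open Scope complex_scope.

Definition omega (R : realType) : Type := nat -> R[i].

(* [normc] is used for the modulus because it is [R]-valued,
   whereas [`|z|] lives in [R[i]]. *)
Definition modulus (R : realType) (z : R[i]) : R := ComplexField.Normc.normc z.

Definition qnum (R : realType) (q x : R) : R := (1 - q `^ x) / (1 - q).

Definition qfact (R : realType) (q : R) (n : nat) : R :=
  \prod_(1 <= i < n.+1) qnum q i%:R.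

Definition nabla (R : realType) (q gamma : R) (g : omega R) : omega R :=
  fun j => \sum_(k < j.+1)
    ((-1) ^+ (j - k) * q ^+ 'C(j - k, 2)
       * ((\prod_(i < j - k) qnum q (gamma - i%:R)) / qfact q (j - k)))%:C
    * g k.

Definition zeta (R : realType) (q gamma : R) (k : nat) : omega R :=
  fun j => if (k <= j)%N
    then ((\prod_(i < j - k) qnum q (gamma + i%:R)) / qfact q (j - k))%:C
    else 0.

(* Since [0 `^ p = 0] for [p != 0], zero terms contribute nothing. *)
Definition lp (R : realType) (p : R) : set (omega R) :=
  [set h | cvgn (series (fun j => modulus (h j) `^ p))].

(* A norm for [1 <= p], and a [p]-norm (no [p]-th root) for [0 < p < 1];
   meaningful on [lp p] only. *)
Definition lp_norm (R : realType) (p : R) (h : omega R) : R :=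
  let s := limn (series (fun j => modulus (h j) `^ p)) in
  if 1 <= p then s `^ p^-1 else s.

Definition linfty (R : realType) : set (omega R) :=
  [set h | has_ubound (range (fun j => modulus (h j)))].

(* Meaningful on [linfty] only. *)
Definition linfty_norm (R : realType) (h : omega R) : R :=
  sup (range (fun j => modulus (h j))).

Definition nabla_space (R : realType) (q gamma : R) (X : set (omega R)) :
    set (omega R) :=
  [set g | X (nabla q gamma g)].

Definition nabla_norm (R : realType) (q gamma : R) (N : omega R -> R) :
    omega R -> R :=
  fun g => N (nabla q gamma g).

Definition has_expansion (R : realType) (N : omega R -> R)
    (b : nat -> omega R) (alpha : nat -> R[i]) (g : omega R) : Prop :=
  N (fun i => g i - \sum_(k < j.+1) alpha k * b k i) @[j --> \oo] --> (0 : R).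

(* Uniqueness of the scalars is not part of the definition. *)
Definition schauder_basis (R : realType) (X : set (omega R))
    (N : omega R -> R) (b : nat -> omega R) : Prop :=
  (forall k, X (b k)) /\
  (forall g, X g -> exists alpha : nat -> R[i], has_expansion N b alpha g).

(* Main.v *)
Require Import Defs.
From mathcomp Require Import all_boot all_order all_algebra.
From mathcomp Require Import all_classical all_reals all_analysis.
From mathcomp Require Import complex ring lra.

(** The operator is a convolution with the coefficients of the power series
    (x;q)_oo / (q^gamma x;q)_oo, and the zeta sequences are the shifts of the
    coefficients of the inverse series. Hence the operator maps the k-th zeta
    sequence to the k-th unit sequence ([nabla_zeta]); that the two series are
    inverse to each other is proved by Gosper summation, with no power series
    ([q_convolution_inverse]). The operator is linear, onto the space of all
    sequences ([nabla_surj]), and the norms are pulled back along it, so the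
    two claims reduce to the plain spaces lp and linfty.

    In lp, subtracting the first terms of the expansion along the unit
    sequences leaves a tail, whose norm tends to 0
    ([lp_norm_remainder_cvg0]), and convergence in norm forces the
    coefficients coordinate by coordinate ([lp_norm_remainder_unique]).

    A Schauder basis would make linfty separable: the finite combinations of
    its elements with rational complex coefficients are countable and dense.
    A diagonal argument shows that no countable family is dense
    ([linfty_diagonal], [linfty_no_schauder_basis]). *)

Import Order.TTheory GRing.Theory Num.Theory.
Import numFieldNormedType.Exports.

Local Open Scope ring_scope.

(** * The q-difference operator and its inverse *)

(** Gosper summation. The recurrences are those of the coefficients of
    (x;q)_oo / (yx;q)_oo and (yx;q)_oo / (x;q)_oo, two mutually inverse power
    series. Their convolution is telescoping: with Q = q^K and N = q^n, the
    partial sum up to K is (1 - yQ)(Q - N) / (Q (1 - y)(1 - N)) times its last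
    summand, the q-analogue of the case c = a + b + 1 in which a
    hypergeometric 2F1 at 1 is indefinitely summable. Denominators are
    cleared, so the induction step is a polynomial identity. *)
Lemma q_convolution_partial_sum (F : comNzRingType) (q y : F) (a b : nat -> F)
    (aS : forall m, a m.+1 * (1 - q ^+ m.+1) = - a m * (q ^+ m - y))
    (bS : forall m, b m.+1 * (1 - q ^+ m.+1) = b m * (1 - y * q ^+ m))
    (b0 : b 0%N = 1) (n K : nat) : (K <= n)%N ->
  (1 - y) * (1 - q ^+ n) * q ^+ K * (\sum_(k < K.+1) a (n - k)%N * b k)
  = (1 - y * q ^+ K) * (q ^+ K - q ^+ n) * (a (n - K)%N * b K).
Proof.
elim: K => [|K IH] Kn; first by rewrite big_ord1 b0 !expr0 !mulr1.
rewrite big_ord_recr /=; have := IH (ltnW Kn).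
have [m En] : exists m, n = (m + K.+1)%N by exists (n - K.+1)%N; rewrite subnK.
have -> : (n - K.+1 = m)%N by rewrite En addnK.
have -> : (n - K = m.+1)%N by rewrite En addnS -addSn addnK.
have := aS m; have := bS K; rewrite En exprD !exprS.
move: (\sum_(k < _) _) (q ^+ K) (q ^+ m) (a m) (a m.+1) (b K) (b K.+1).
move=> S Q P am amS bK bKS hb ha hS.
(* Both recurrences are used up here: what is left involves only [am] and
   [bKS]. *)
have e1 : (1 - y) * (1 - P * (q * Q)) * Q * S
    = - (Q * am * (P - y) * (bKS * (1 - q * Q))).
  rewrite hS hb.
  have -> : (1 - y * Q) * (Q - P * (q * Q)) * (amS * bK)
    = (1 - y * Q) * Q * bK * (amS * (1 - q * P)) by ring.
  by rewrite ha; ring.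
have -> : (1 - y) * (1 - P * (q * Q)) * (q * Q) * (S + am * bKS)
   = q * ((1 - y) * (1 - P * (q * Q)) * Q * S)
     + (1 - y) * (1 - P * (q * Q)) * (q * Q) * am * bKS by ring.
by rewrite e1; ring.
Qed.

(** For n > 0 the factor q^K - q^n of the telescoped sum vanishes at K = n. *)
Lemma q_convolution_inverse (F : idomainType) (q y : F) (a b : nat -> F)
    (q_neq0 : q != 0) (q_nroot : forall n, q ^+ n.+1 != 1) (y_neq1 : y != 1)
    (aS : forall m, a m.+1 * (1 - q ^+ m.+1) = - a m * (q ^+ m - y))
    (bS : forall m, b m.+1 * (1 - q ^+ m.+1) = b m * (1 - y * q ^+ m))
    (a0 : a 0%N = 1) (b0 : b 0%N = 1) (n : nat) :
  \sum_(k < n.+1) a (n - k)%N * b k = (n == 0)%:R.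
Proof.
case: n => [|n]; first by rewrite big_ord1 a0 b0 mulr1.
have := @q_convolution_partial_sum F q y a b aS bS b0 n.+1 n.+1 (leqnn _).
rewrite subrr mulr0 mul0r => /eqP; rewrite !mulf_eq0 !subr_eq0.
rewrite (eq_sym 1 y) (negbTE y_neq1) (eq_sym 1) (negbTE (q_nroot n)) /=.
by rewrite expf_eq0 (negbTE q_neq0) /= => /eqP.
Qed.

Section difference_operator.
Variables (R : realType) (q gamma : R).
Hypotheses (q_gt0 : 0 < q) (q_lt1 : q < 1).

Definition nabla_coef (m : nat) : R :=
  (-1) ^+ m * q ^+ 'C(m, 2) * ((\prod_(i < m) qnum q (gamma - i%:R)) / qfact q m).

Definition zeta_coef (m : nat) : R :=
  (\prod_(i < m) qnum q (gamma + i%:R)) / qfact q m.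

Lemma expr_q_neq1 n : q ^+ n.+1 != 1.
Proof. by rewrite lt_eqF ?exprn_ilt1 ?ltW. Qed.

Lemma qfactS m : qfact q m.+1 = qfact q m * ((1 - q ^+ m.+1) / (1 - q)).
Proof.
by rewrite /qfact big_nat_recr //= /qnum powR_mulrn // ltW.
Qed.

Lemma qfact0 : qfact q 0 = 1.
Proof. by rewrite /qfact big_geq. Qed.

Lemma one_sub_q_neq0 : 1 - q != 0.
Proof. by rewrite subr_eq0 eq_sym lt_eqF. Qed.

Lemma one_sub_qX_neq0 m : 1 - q ^+ m.+1 != 0.
Proof. by rewrite subr_eq0 eq_sym expr_q_neq1. Qed.

Lemma qfact_neq0 m : qfact q m != 0.
Proof.
elim: m => [|m IH]; first by rewrite qfact0 oner_neq0.
by rewrite qfactS !mulf_neq0 ?invr_neq0 ?one_sub_q_neq0 ?one_sub_qX_neq0.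
Qed.

Lemma nabla_coef0 : nabla_coef 0 = 1.
Proof. by rewrite /nabla_coef big_ord0 qfact0 !expr0 invr1 !mulr1. Qed.

Lemma zeta_coef0 : zeta_coef 0 = 1.
Proof. by rewrite /zeta_coef big_ord0 qfact0 invr1 mulr1. Qed.

(** Together with [zeta_coefS], this is the hypothesis of the convolution
    identity for y = q^gamma; the power q^m comes from
    'C(m + 1, 2) = 'C(m, 2) + m. *)
Lemma nabla_coefS m : nabla_coef m.+1 * (1 - q ^+ m.+1)
  = - nabla_coef m * (q ^+ m - q `^ gamma).
Proof.
rewrite /nabla_coef big_ord_recr /= qfactS binS bin1 exprD [in LHS]exprS /qnum.
rewrite powRB ?(gt_eqF q_gt0) ?implybT // powR_mulrn ?ltW //.
have h1 := one_sub_q_neq0; have h2 := one_sub_qX_neq0 m.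
have h3 := qfact_neq0 m; have h4 : q ^+ m != 0 by rewrite expf_neq0 // gt_eqF.
move: (q ^+ m.+1) (q ^+ m) (qfact q m) h1 h2 h3 h4 => u v w h1 h2 h3 h4.
by field; rewrite h1 h2 h3 h4.
Qed.

Lemma zeta_coefS m : zeta_coef m.+1 * (1 - q ^+ m.+1)
  = zeta_coef m * (1 - q `^ gamma * q ^+ m).
Proof.
rewrite /zeta_coef big_ord_recr /= qfactS /qnum.
rewrite powRD ?(gt_eqF q_gt0) ?implybT // powR_mulrn ?ltW //.
have h1 := one_sub_q_neq0; have h2 := one_sub_qX_neq0 m.
have h3 := qfact_neq0 m.
move: (q ^+ m.+1) (q ^+ m) (qfact q m) h1 h2 h3 => u v w h1 h2 h3.
by field; rewrite h1 h2 h3.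
Qed.

Lemma nablaE (g : omega R) j :
  nabla q gamma g j = \sum_(k < j.+1) ((nabla_coef (j - k))%:C)%C * g k.
Proof. by []. Qed.

(** The operator turns expansion remainders into expansion remainders, so every
    question about bases of a domain space becomes one about the images. *)
Lemma nabla_sub_sum (n : nat) (g : omega R) (alpha : nat -> R[i])
    (b : nat -> omega R) :
  nabla q gamma (fun i => g i - \sum_(k < n) alpha k * b k i)
  = fun i => nabla q gamma g i - \sum_(k < n) alpha k * nabla q gamma (b k) i.
Proof.
apply/funext => i; rewrite !nablaE.
under eq_bigr do rewrite mulrBr.
rewrite sumrB; congr (_ - _).
under eq_bigr do rewrite mulr_sumr.
rewrite exchange_big /=; apply: eq_bigr => k _.
rewrite nablaE mulr_sumr; apply: eq_bigr => l _.
by rewrite mulrCA.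
Qed.

Hypothesis gamma_gt0 : 0 < gamma.

Lemma powR_q_gamma_neq1 : q `^ gamma != 1.
Proof.
by rewrite powR_eq1 (lt_eqF q_lt1) (lt_gtF q_gt0) (gt_eqF gamma_gt0).
Qed.

(** The entries of the zeta sequence before [k] vanish; shifted by [k], the
    remaining sum is the convolution of the two inverse coefficient sequences. *)
Lemma nabla_zeta k j : nabla q gamma (zeta q gamma k) j = (j == k)%:R.
Proof.
rewrite nablaE.
have [jk|kj] := ltnP j k.
  rewrite (ltn_eqF jk) big1 // => i _; rewrite /zeta leqNgt.
  by rewrite (leq_trans (ltn_ord i) jk) /= mulr0.
have -> : (j == k) = (j - k == 0)%N by rewrite subn_eq0 eqn_leq kj andbT.
rewrite -(big_mkord xpredT (fun i => ((nabla_coef (j - i))%:C)%C * zeta q gamma k i)).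
rewrite (big_cat_nat (n := k)) //=; last exact: leqW.
rewrite big_nat big1 ?add0r; last first.
  by move=> i /andP[_ ik]; rewrite /zeta leqNgt ik /= mulr0.
rewrite -{1}(add0n k) big_addn subSn // big_mkord.
rewrite -[RHS](rmorph_nat (real_complex R)).
rewrite -(@q_convolution_inverse R q (q `^ gamma) nabla_coef zeta_coef
   _ expr_q_neq1 powR_q_gamma_neq1 nabla_coefS zeta_coefS nabla_coef0
   zeta_coef0) ?gt_eqF //.
rewrite rmorph_sum; apply: eq_bigr => i _.
rewrite [RHS]rmorphM /= /zeta leq_addl addnK; congr (_ * _).
by rewrite [(i + k)%N]addnC subnDA.
Qed.

(** Since the operator is lower triangular and maps the zeta sequences to the
    unit sequences, the combination of the zeta sequences with coefficients
    [h], finite in each coordinate, is a preimage of [h]. *)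
Lemma nabla_surj (h : omega R) : exists g, nabla q gamma g = h.
Proof.
exists (fun i => \sum_(k < i.+1) h k * zeta q gamma k i).
apply/funext => j; rewrite nablaE.
transitivity (\sum_(k < j.+1) h k * nabla q gamma (zeta q gamma k) j).
  under [RHS]eq_bigr do rewrite nablaE mulr_sumr.
  rewrite [RHS]exchange_big /=; apply: eq_bigr => i _.
  rewrite mulr_sumr (big_ord_widen j.+1 (fun k =>
    (nabla_coef (j - i))%:C%C * (h k * zeta q gamma k i))) ?ltn_ord //.
  rewrite big_mkcond; apply: eq_bigr => k _.
  by rewrite ltnS /zeta; case: leqP => _; [exact: mulrCA|rewrite !mulr0].
under eq_bigr do rewrite nabla_zeta.
rewrite big_ord_recr /= eqxx mulr1 big1 ?add0r // => i _.
by rewrite gtn_eqF // mulr0.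
Qed.

End difference_operator.

(** * Moduli and finite combinations *)

Section sequence_spaces.
Variable R : realType.

Lemma modulus_ge0 (z : R[i]) : 0 <= modulus z.
Proof. by case: z => x y; exact: sqrtr_ge0. Qed.

Lemma modulus0 : modulus (0 : R[i]) = 0.
Proof. exact: ComplexField.Normc.normc0. Qed.

Lemma modulusM (z w : R[i]) : modulus (z * w) = modulus z * modulus w.
Proof. exact: ComplexField.Normc.normcM. Qed.

Lemma modulusD_le (z w : R[i]) : modulus (z + w) <= modulus z + modulus w.
Proof. exact: (@le_normcD R z w). Qed.

Lemma modulusN (z : R[i]) : modulus (- z) = modulus z.
Proof. exact: (@normcN R z). Qed.

Lemma sum_mul_delta (n i : nat) (alpha : nat -> R[i]) :
  \sum_(k < n) alpha k * (i == k :> nat)%:R = if (i < n)%N then alpha i else 0.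
Proof.
case: ltnP => ni.
  rewrite (bigD1 (Ordinal ni)) //= eqxx mulr1 big1 ?addr0 // => k.
  rewrite -val_eqE /= eq_sym => /negPf ->; exact: mulr0.
by rewrite big1 // => k _; rewrite gtn_eqF ?mulr0 // (leq_trans (ltn_ord k)).
Qed.

Lemma cvgn_powR0 (u : nat -> R) (r : R) : 0 < r -> (forall n, 0 <= u n) ->
  (u n @[n --> \oo] --> (0 : R))%classic ->
  (u n `^ r @[n --> \oo] --> (0 : R))%classic.
Proof.
move=> r0 u0 /cvgr0Pnorm_lt cu; apply/cvgr0Pnorm_lt => e e0.
have er : 0 < e `^ r^-1 by exact: powR_gt0.
near=> n; rewrite ger0_norm ?powR_ge0 //.
have -> : e = (e `^ r^-1) `^ r.
  by rewrite -powRrM mulVf ?gt_eqF // powRr1 // ltW.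
rewrite gt0_ltr_powR ?nnegrE ?powR_ge0 //.
rewrite -(ger0_norm (u0 n)); near: n; exact: cu.
Unshelve. all: by end_near. Qed.

(** * Expansions along the unit sequences in the lp spaces *)

Section lp_spaces.
Variable p : R.
Hypothesis p_gt0 : 0 < p.

Lemma lp_eventually (N : nat) (h h' : omega R) :
  (forall i, (N <= i)%N -> h i = h' i) -> lp p h -> lp p h'.
Proof.
rewrite /lp /= => hh'; rewrite -(is_cvg_series_restrict N) => ch.
rewrite -(is_cvg_series_restrict N).
suff eq_sum n : \sum_(N <= k < n) modulus (h' k) `^ p
    = \sum_(N <= k < n) modulus (h k) `^ p by under eq_fun do rewrite eq_sum.
by apply: eq_big_nat => i /andP[Ni _]; rewrite hh'.
Qed.

Lemma lp_delta (k : nat) :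
  lp p (fun j => (j == k)%:R : R[i]).
Proof.
apply: (@lp_eventually k.+1 (fun=> 0)) => [j kj|].
  by rewrite gtn_eqF.
suff s0 : series (fun=> modulus (0 : R[i]) `^ p) = fun=> 0.
  by rewrite /lp /mkset s0; exact: is_cvg_cst.
apply/funext => n; rewrite modulus0 powR0 ?gt_eqF //.
exact: big1_eq.
Qed.

Lemma series_modulus_powR_nd (h : omega R) :
  nondecreasing_seq (series (fun j => modulus (h j) `^ p)).
Proof. by apply: nondecreasing_series => i _ _; exact: powR_ge0. Qed.

Lemma modulus_powR_le_lim (h : omega R) i : lp p h ->
  modulus (h i) `^ p <= limn (series (fun j => modulus (h j) `^ p)).
Proof.
move=> ch; apply: le_trans (nondecreasing_cvgn_le (series_modulus_powR_nd h) ch i.+1).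
rewrite seriesEnat /= big_nat_recr //= lerDr.
by apply: sumr_ge0 => k _; exact: powR_ge0.
Qed.

Lemma lim_series_modulus_ge0 (h : omega R) : lp p h ->
  0 <= limn (series (fun j => modulus (h j) `^ p)).
Proof. by move=> ch; apply: le_trans (modulus_powR_le_lim h 0 ch); exact: powR_ge0. Qed.

(** Handles the norm and the p-norm at once: r is 1/p or 1. *)
Lemma lp_norm_powRE : exists2 r : R, 0 < r & forall h : omega R, lp p h ->
  lp_norm p h = limn (series (fun j => modulus (h j) `^ p)) `^ r.
Proof.
rewrite /lp_norm; case: (1 <= p); first by exists p^-1; rewrite ?invr_gt0.
by exists 1 => // h ch; rewrite powRr1 // lim_series_modulus_ge0.
Qed.

(** Needed because the norm is an honest sum only for sequences of the space;
    for arbitrary [alpha] the remainder differs from [h] in finitely many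
    coordinates. *)
Lemma lp_sub_sum_delta (h : omega R) (alpha : nat -> R[i]) j : lp p h ->
  lp p (fun i => h i - \sum_(k < j.+1) alpha k * (i == k :> nat)%:R).
Proof.
apply: (@lp_eventually j.+1) => i ji.
by rewrite sum_mul_delta ltnNge ji subr0.
Qed.

(** The remainder is [h] with its first coordinates erased, so its p-th power
    sum is the tail of a convergent series. *)
Lemma lp_norm_remainder_cvg0 (h : omega R) : lp p h ->
  (lp_norm p (fun i => h i - \sum_(k < j.+1) h k * (i == k :> nat)%:R)
     @[j --> \oo] --> (0 : R))%classic.
Proof.
move=> ch; have [r r0 normE] := lp_norm_powRE.
under eq_fun do rewrite (normE _ (lp_sub_sum_delta h h _ ch)).
apply: cvgn_powR0 => // [n|].
  by apply: lim_series_modulus_ge0; exact: lp_sub_sum_delta.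
pose u i := modulus (h i) `^ p.
suff remE j : limn (series (fun i => modulus
    (h i - \sum_(k < j.+1) h k * (i == k :> nat)%:R) `^ p))
    = limn (series u) - series u j.+1.
  under eq_fun do rewrite remE.
  have -> : nbhs (0 : R) = nbhs (limn (series u) - limn (series u)) by rewrite subrr.
  apply: cvgB; first exact: cvg_cst.
  by rewrite (cvg_shiftS (series u)).
apply/cvg_lim => //.
have : (series u n - series u j.+1 @[n --> \oo]
   --> limn (series u) - series u j.+1)%classic.
  by apply: cvgB => //; exact: cvg_cst.
apply: cvg_trans; apply: near_eq_cvg; near=> n.
have jn : (j.+1 <= n)%N by near: n; exact: nbhs_infty_ge.
rewrite sub_series jn; apply/esym; rewrite seriesEnat /= (big_cat_nat (n := j.+1)) //=.
rewrite [X in X + _]big_nat big1 ?add0r; last first.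
  move=> i /andP[_ ij] /=; rewrite sum_mul_delta ij subrr modulus0.
  by rewrite powR0 // gt_eqF.
apply: eq_big_nat => i /andP[ji _] /=.
by rewrite sum_mul_delta ltnNge ji subr0.
Unshelve. all: by end_near. Qed.

(** From stage [i] on, coordinate [i] of the remainder is the constant
    [h i - alpha i], whose modulus is controlled by a norm that tends to 0. *)
Lemma lp_norm_remainder_unique (h : omega R) (alpha : nat -> R[i]) : lp p h ->
  (lp_norm p (fun i => h i - \sum_(k < j.+1) alpha k * (i == k :> nat)%:R)
     @[j --> \oo] --> (0 : R))%classic ->
  alpha = h.
Proof.
move=> ch; have [r r0 normE] := lp_norm_powRE.
under eq_fun do rewrite (normE _ (lp_sub_sum_delta h alpha _ ch)).
move=> c0; apply/funext => i; apply/esym/eqP; rewrite -subr_eq0; apply/eqP.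
apply: ComplexField.Normc.eq0_normc.
suff : (modulus (h i - alpha i) `^ p) `^ r <= 0.
  move=> le0; apply: (@powR_eq0_eq0 _ _ p); apply: (@powR_eq0_eq0 _ _ r).
  by apply/eqP; rewrite eq_le le0 powR_ge0.
apply: (cvgr_to_ge c0); near=> j.
have ij : (i <= j)%N by near: j; exact: nbhs_infty_ge.
have := modulus_powR_le_lim _ i (lp_sub_sum_delta h alpha j ch).
rewrite sum_mul_delta ltnS ij => le.
apply: ge0_ler_powR le; rewrite ?ltW ?nnegrE ?powR_ge0 //.
exact: lim_series_modulus_ge0 _ (lp_sub_sum_delta h alpha j ch).
Unshelve. all: by end_near. Qed.

End lp_spaces.

(** * Bounded sequences *)

Lemma linfty_norm_ge (h : omega R) i : linfty h -> modulus (h i) <= linfty_norm h.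
Proof. by move=> bh; apply: ub_le_sup => //; exists i. Qed.

Lemma modulus_sum_le (n : nat) (f : nat -> R[i]) :
  modulus (\sum_(k < n) f k) <= \sum_(k < n) modulus (f k).
Proof.
elim/big_ind2: _ => [|x x' y y' hx hy|//]; first by rewrite modulus0.
exact: le_trans (modulusD_le _ _) (lerD hx hy).
Qed.

Lemma modulus_lincomb_le (n : nat) (b : nat -> omega R) (alpha : nat -> R[i]) i :
  (forall k, linfty (b k)) ->
  modulus (\sum_(k < n) alpha k * b k i)
    <= \sum_(k < n) modulus (alpha k) * linfty_norm (b k).
Proof.
move=> bb; apply: le_trans (modulus_sum_le n (fun k => alpha k * b k i)) _.
apply: ler_sum => k _; rewrite modulusM.
by rewrite ler_wpM2l ?modulus_ge0 ?linfty_norm_ge.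
Qed.

Lemma linfty_sub_lincomb (n : nat) (b : nat -> omega R) (alpha : nat -> R[i])
    (h : omega R) : linfty h -> (forall k, linfty (b k)) ->
  linfty (fun i => h i - \sum_(k < n) alpha k * b k i).
Proof.
move=> bh bb; exists (linfty_norm h
    + \sum_(k < n) modulus (alpha k) * linfty_norm (b k)) => _ [i _ <-].
apply: le_trans (modulusD_le _ _) _.
by rewrite modulusN lerD ?linfty_norm_ge ?modulus_lincomb_le.
Qed.

(** Non-separability, in diagonal form: coordinate [m] of [h] is a sign chosen
    away from coordinate [m] of [d m]. One of 1 and -1 is at distance at least
    1 from any given number, because they are at distance 2 from each other. *)
Lemma linfty_diagonal (d : nat -> omega R) :
  exists2 h : omega R, linfty h & forall m, 1 <= modulus (h m - d m m).
Proof.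
have m1 : modulus (1 : R[i]) = 1 by exact: ComplexField.Normc.normc1.
exists (fun m => if 1 <= modulus (1 - d m m) then 1 else -1).
  by exists 1 => _ [m _ <-]; case: ifP; rewrite ?modulusN m1.
move=> m; case: ifPn => //; rewrite -ltNge => lt1.
have : 2 <= modulus (1 - d m m) + modulus (-1 - d m m).
  rewrite -[X in _ + X]modulusN opprB opprK.
  apply: le_trans (modulusD_le _ _).
  have -> : 1 - d m m + (d m m + 1) = 1 + 1 :> R[i] by ring.
  have -> : 1 + 1 = (2 : R)%:C%C by rewrite rmorphD.
  by rewrite /modulus /= expr0n /= addr0 sqrtr_sqr ger0_norm.
by move: lt1; lra.
Qed.

Definition rat_complex (c : rat * rat) : R[i] := (ratr c.1 +i* ratr c.2)%C.

Lemma rat_complex_dense (z : R[i]) (e : R) : 0 < e ->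
  exists c, modulus (z - rat_complex c) < e.
Proof.
case: z => x y e0.
have approx (t : R) : exists a : rat, `|t - ratr a| < e / 2.
  have [|a] := @rat_in_itvoo R (t - e / 2) (t + e / 2); first lra.
  by rewrite in_itv /= => /andP[h1 h2]; exists a; rewrite ltr_norml; lra.
have [a ha] := approx x; have [b hb] := approx y.
exists (a, b).
have -> : (x +i* y)%C - rat_complex (a, b)
   = ((x - ratr a) +i* 0)%C + (0 +i* (y - ratr b))%C.
  by apply/eqP; rewrite eq_complex /= !addr0 !add0r !eqxx.
apply: le_lt_trans (modulusD_le _ _) _.
by rewrite /modulus /= expr0n /= addr0 add0r !sqrtr_sqr; lra.
Qed.

(** A basis would make the finite combinations with rational complex
    coefficients dense. They are enumerated by pickling the list of
    coefficients, and the diagonal sequence stays at distance at least 1 from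
    all of them. *)
Lemma linfty_no_schauder_basis :
  ~ exists b : nat -> omega R, schauder_basis (@linfty R) (@linfty_norm R) b.
Proof.
move=> [b [bb expand]].
pose d m : omega R := fun i => let s := odflt [::] (unpickle m) in
  \sum_(k < size s) rat_complex (nth (0, 0) s k) * b k i.
have [h bh hd] := linfty_diagonal d.
have [alpha /cvgr0Pnorm_lt /(_ (1 / 2)) []] := expand h bh; first lra.
move=> N _ /(_ N (leqnn _)) /= close.
(* Rounding each coefficient [k] by less than [e k] moves the combination by
   at most 1/2; the summand 1 covers a basis element of norm 0. *)
pose e k : R := (2 * N.+1%:R * (linfty_norm (b k) + 1))^-1.
have M0 k : 0 <= linfty_norm (b k).
  exact: le_trans (modulus_ge0 _) (linfty_norm_ge (b k) 0 (bb k)).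
have e0 k : 0 < e k.
  by rewrite invr_gt0 !mulr_gt0 ?ltr0Sn // ltr_wpDl.
have [c hc] := choice (fun k => rat_complex_dense (alpha k) (e k) (e0 k)).
have := hd (pickle (mkseq c N.+1)); apply/negP; rewrite -ltNge.
set m := pickle _.
have -> : d m m = \sum_(k < N.+1) rat_complex (c k) * b k m.
  rewrite /d /m pickleK -[odflt _ _]/(mkseq c N.+1) size_mkseq; apply: eq_bigr => k _.
  by rewrite nth_mkseq.
have -> : h m - \sum_(k < N.+1) rat_complex (c k) * b k m
  = (h m - \sum_(k < N.+1) alpha k * b k m)
    + \sum_(k < N.+1) (alpha k - rat_complex (c k)) * b k m.
  under [X in _ = _ + X]eq_bigr do rewrite mulrBl.
  by rewrite sumrB addrA subrK.
apply: le_lt_trans (modulusD_le _ _) _.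
have h1 : modulus (h m - \sum_(k < N.+1) alpha k * b k m) < 1 / 2.
  apply: le_lt_trans close; apply: le_trans (ler_norm _).
  exact: (linfty_norm_ge _ m (linfty_sub_lincomb _ _ _ _ bh bb)).
have h2 : modulus (\sum_(k < N.+1) (alpha k - rat_complex (c k)) * b k m) <= 1 / 2.
  apply: le_trans (modulus_lincomb_le N.+1 b
    (fun k => alpha k - rat_complex (c k)) m bb) _.
  apply: (@le_trans _ _ (\sum_(k < N.+1) (2 * N.+1%:R)^-1)).
    apply: ler_sum => k _.
    apply: (@le_trans _ _ (e k * (linfty_norm (b k) + 1))).
      by rewrite ler_pM ?modulus_ge0 ?lerDl // ltW.
    have M1 : linfty_norm (b k) + 1 != 0 by rewrite gt_eqF // ltr_wpDl.
    by rewrite /e invfM mulfVK.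
  have N0 : N.+1%:R != 0 :> R by rewrite pnatr_eq0.
  rewrite sumr_const card_ord -[X in X <= _]mulr_natr.
  by have -> : (2 * N.+1%:R)^-1 * N.+1%:R = 1 / 2 :> R by field.
by lra.
Qed.

End sequence_spaces.

(** * Bases of the domain spaces *)

Theorem theorem2p5 (R : realType) (q gamma p : R)
    (q_gt0 : 0 < q) (q_lt1 : q < 1) (gamma_gt0 : 0 < gamma) (p_gt0 : 0 < p) :
  (schauder_basis (nabla_space q gamma (lp p))
     (nabla_norm q gamma (lp_norm p)) (zeta q gamma)
   /\ (forall g : omega R, nabla_space q gamma (lp p) g ->
        has_expansion (nabla_norm q gamma (lp_norm p)) (zeta q gamma)
          (nabla q gamma g) g
        /\ (forall alpha : nat -> R[i],
              has_expansion (nabla_norm q gamma (lp_norm p)) (zeta q gamma)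
                alpha g ->
              alpha = nabla q gamma g)))
  /\ ~ (exists b : nat -> omega R,
          schauder_basis (nabla_space q gamma (@linfty R))
            (nabla_norm q gamma (@linfty_norm R)) b).
Proof.
have nabla_rem (g : omega R) (alpha : nat -> R[i]) j : nabla q gamma
    (fun i => g i - \sum_(k < j.+1) alpha k * zeta q gamma k i)
  = fun i => nabla q gamma g i - \sum_(k < j.+1) alpha k * (i == k :> nat)%:R.
  rewrite nabla_sub_sum; apply/funext => i; congr (_ - _).
  by apply: eq_bigr => k _; rewrite nabla_zeta.
have expandE (g : omega R) (alpha : nat -> R[i]) :
    has_expansion (nabla_norm q gamma (lp_norm p)) (zeta q gamma) alpha g
  = (lp_norm p (fun i => nabla q gamma g i
       - \sum_(k < j.+1) alpha k * (i == k :> nat)%:R)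
     @[j --> \oo] --> (0 : R))%classic.
  by rewrite /has_expansion /nabla_norm; under eq_fun do rewrite nabla_rem.
split; last first.
  move=> [b [bb expand]]; apply: (@linfty_no_schauder_basis R).
  exists (fun k => nabla q gamma (b k)); split => // h bh.
  have [g gh] := nabla_surj R q gamma q_gt0 q_lt1 gamma_gt0 h.
  have [|alpha] := expand g; first by rewrite /nabla_space /= gh.
  rewrite /has_expansion /nabla_norm => c0; exists alpha; move: c0.
  by under eq_fun do rewrite nabla_sub_sum gh.
have expand g : nabla_space q gamma (lp p) g ->
    has_expansion (nabla_norm q gamma (lp_norm p)) (zeta q gamma)
      (nabla q gamma g) g.
  by move=> gX; rewrite expandE; exact: lp_norm_remainder_cvg0.
split; first split.
- move=> k; rewrite /nabla_space /mkset.
  have -> : nabla q gamma (zeta q gamma k) = fun j => (j == k)%:R.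
    by apply/funext => j; rewrite nabla_zeta.
  exact: lp_delta.
- by move=> g gX; exists (nabla q gamma g); exact: expand.
- move=> g gX; split => [|alpha]; first exact: expand.
  by rewrite expandE; exact: lp_norm_remainder_unique.
Qed.
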